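(* Let $k\geq 1$. Any oblivious branching program of length $T\le kn$ computing the low order bit of the median of $n$ integers from $[2n]$ requires size at least $$2^{\tilde\Omega\left(n^{1/2^{4k+2}}\right)};$$ in particular, this size is super-polynomial in $n$ when $T$ is $o(n\log\log n)$.
   Context: $\log$ denotes $\log_2$; $[N]=\{1,\dots,N\}$; $\tilde\Omega$ hides (poly)logarithmic factors in $n$ (as well as constant factors). For $n$ input integers, the median is the middle element in sorted order (the $n/2$-th largest when $n$ is even). In the ''in particular'' clause, $k=T/n$ is allowed to depend on $n$. A branching program on $n$ inputs from a finite set $D$ (here $D=[2n]$) is a connected directed acyclic multigraph with a source node and possibly many sink nodes; each non-sink node is labeled by an input index in $[n]$ and has exactly one out-edge labeled by each element of $D$; each sink is labeled by an output value. On input $x\in D^n$, the computation starts at the source and at each node queries the input at the node's index and follows the edge labeled by its value, until a sink is reached, whose label is the output. Its size is its number of nodes, and its length (time) $T$ is the length of the longest path from the source to a sink. It is oblivious if on every path from the source to a sink the sequence of input indices is precisely the same. *)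

(* Defs.v *)
From HB Require Import structures.
From mathcomp Require Import all_boot all_order all_algebra.
From mathcomp Require Import all_classical all_reals all_analysis.
Import Order.TTheory GRing.Theory Num.Theory.
Import numFieldNormedType.Exports.
Set Implicit Arguments.
Unset Strict Implicit.
Unset Printing Implicit Defensive.

(* Branching programs on n inputs from D with outputs in O.  The node v is a
   sink with output o when [bp_node_kind v = inl o], and queries the input of
   index i when [bp_node_kind v = inr (i, succ)]; then [succ a] is the endpoint
   of its out-edge labeled a, so distinct labels may give parallel edges. *)
Record bp_graph (n : nat) (D : finType) (O : Type) := BPGraph {
  bp_node : finType;
  bp_source : bp_node;
  bp_node_kind : bp_node -> O + 'I_n * (D -> bp_node)
}.

Section Graph.
Variables (n : nat) (D : finType) (O : Type) (P : bp_graph n D O).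

Definition bp_edge : rel (bp_node P) := fun u v =>
  if bp_node_kind u is inr (_, succ) then [exists a, succ a == v] else false.

Definition bp_acyclic : Prop :=
  forall u v, bp_edge u v -> ~~ connect bp_edge v u.

Definition bp_connected : Prop :=
  forall u v, connect (fun a b => bp_edge a b || bp_edge b a) u v.

(* Uniqueness of the node without incoming edges is not required. *)
Definition bp_source_ok : Prop := forall u, ~~ bp_edge u (bp_source P).

(* [bp_trace v w] is [Some s] when the edge labels w spell a path from v ending
   at a sink, s being the sequence of input indices queried along this path;
   it is [None] when w stops before a sink or continues past one. *)
Fixpoint bp_trace (v : bp_node P) (w : seq D) : option (seq 'I_n) :=
  match bp_node_kind v, w with
  | inl _, [::] => Some [::]
  | inr (i, succ), a :: w' => omap (cons i) (bp_trace (succ a) w')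
  | _, _ => None
  end.

Definition bp_step (x : n.-tuple D) (v : bp_node P) : bp_node P :=
  if bp_node_kind v is inr (i, succ) then succ (tnth x i) else v.

End Graph.

Record branching_program (n : nat) (D : finType) (O : Type) :=
  BranchingProgram {
    bp_of :> bp_graph n D O;
    bp_acyclicP : bp_acyclic bp_of;
    bp_connectedP : bp_connected bp_of;
    bp_source_okP : bp_source_ok bp_of
  }.

Section Program.
Variables (n : nat) (D : finType) (O : Type) (P : branching_program n D O).

Definition bp_size : nat := #|bp_node P|.

(* Length, in edges, of the longest path from the source to a sink.  By
   acyclicity every path has fewer edges than there are nodes. *)
Definition bp_length : nat :=
  \max_(t < bp_size | [exists w : t.-tuple D, bp_trace (bp_source P) w]) t.

Definition bp_oblivious : Prop :=
  forall (w1 w2 : seq D) (s1 s2 : seq 'I_n),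
    bp_trace (bp_source P) w1 = Some s1 ->
    bp_trace (bp_source P) w2 = Some s2 -> s1 = s2.

Definition bp_outputs (x : n.-tuple D) (o : O) : Prop :=
  exists t : nat, bp_node_kind (iter t (bp_step x) (bp_source P)) = inl o.

Definition bp_computes (f : n.-tuple D -> O) : Prop :=
  forall x, bp_outputs x (f x).

End Program.

(* For odd size this is the middle element; for even size m, the entry of
   (0-based) rank m/2 in increasing order is the m/2-th largest. *)
Definition median (s : seq nat) : nat := nth 0 (sort leq s) (size s)./2.

(* The element i of 'I_(2 * n) stands for the integer i + 1 of {1, ..., 2n}. *)
Definition median_low_bit (n : nat) (x : n.-tuple 'I_(2 * n)) : bool :=
  odd (median [seq (val i).+1 | i <- x]).

Definition log2 (R : realType) (x : R) : R := (ln x / ln 2)%R.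

(* Main.v *)
Require Import Defs.
From HB Require Import structures.
From mathcomp Require Import all_boot all_order all_algebra.
From mathcomp Require Import all_classical all_reals all_analysis.
From mathcomp Require Import fintype finset zify ring lra.
Import Order.TTheory GRing.Theory Num.Theory.
Import numFieldNormedType.Exports.
Set Implicit Arguments.
Unset Strict Implicit.
Unset Printing Implicit Defensive.

(* An adversary argument gives the stronger bound size >= 2^(c n^(1/(8k+2))).
   A sequence of at most kn queries reads half of the inputs at most 2k times
   each; repeatedly halving two disjoint sets of such inputs, following the
   meander lemma of Alon and Maass, leaves sets A and B of size n/2^O(k) and a cut
   of the sequence into O(k) pieces, none of which reads both A and B.  With
   the other inputs fixed, the program is a protocol between the owner of A
   and the owner of B, the message at a cut being the node reached there.

   Hard inputs for m+1 messages are built from hard inputs for m messages: the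
   first speaker holds t independent inputs of the next speaker, and the
   listener holds an index i < t together with one input to be played against
   the i-th of them.  If t is large compared with log size, then on a dense set
   of inputs compatible with the first message some coordinate i is still
   dense, and the adversary continues there.  For the median, the t inputs
   occupy consecutive ranges of values, and the listener moves the median into
   the i-th range by padding with small and large values. *)

(** * Cutting a query sequence into few pieces *)

Fixpoint pieces (I : finType) (A B : {set I}) (c : nat) (s : seq I) : Prop :=
  if c is c'.+1 then
    exists s1 s2, [/\ s = s1 ++ s2,
      ~~ has (mem A) s1 || ~~ has (mem B) s1 & pieces A B c' s2]
  else s = [::].

(** Pieces may be empty, so [c] acts as an upper bound on their number. *)
Lemma pieces1 (I : finType) (A B : {set I}) c s :
  ~~ has (mem A) s || ~~ has (mem B) s -> pieces A B c.+1 s.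
Proof.
elim: c s => [|c IHc] s sAB; first by exists s, [::]; rewrite cats0.
by exists [::], s; split=> //; apply: IHc.
Qed.

Lemma piecesC (I : finType) (A B : {set I}) c s :
  pieces A B c s -> pieces B A c s.
Proof.
elim: c s => //= c IHc s [s1 [s2 [-> s1AB /IHc s2AB]]].
by exists s1, s2; split; rewrite 1?orbC.
Qed.

(** Induction on [a + b]. The first piece is a shortest prefix meeting half of one of the sets. Keep
    in that set the elements met, which have fewer occurrences left, and in the other set those not
    met: both lose at most half, and the piece avoids the second set. *)
Lemma alon_maass (I : finType) (a b N : nat) (A B : {set I}) (s : seq I) :
  [disjoint A & B] ->
  {in A, forall i, count_mem i s <= a} -> {in B, forall i, count_mem i s <= b} ->
  2 ^ (a + b) * N <= #|A| -> 2 ^ (a + b) * N <= #|B| ->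
  exists A' B' : {set I}, [/\ A' \subset A, B' \subset B, N <= #|A'|, N <= #|B'|
    & pieces A' B' (a + b).+1 s].
Proof.
case: (posnP N) => [-> _ _ _ _ _|N_gt0].
  exists set0, set0; rewrite !sub0set; split=> //; apply: pieces1.
  by apply/orP; left; apply/hasPn => i _ /=; rewrite inE.
have [c] := ubnP (a + b); elim: c => // c IHc in a b A B s * => lt_abc dAB sA sB leA leB.
have le_pow k : N <= 2 ^ k * N by rewrite leq_pmull ?expn_gt0.
(* The prefix [s1] meets at least half of [A1], which we keep, and at most
   half of [B1], which we drop. *)
have step (a' b' : nat) (A1 B1 : {set I}) s1 s2 : a' + b' < c.+1 -> [disjoint A1 & B1] ->
    {in A1, forall i, count_mem i (s1 ++ s2) <= a'} ->
    {in B1, forall i, count_mem i (s1 ++ s2) <= b'} ->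
    2 ^ (a' + b') * N <= #|A1| -> 2 ^ (a' + b') * N <= #|B1| ->
    #|A1| <= 2 * #|A1 :&: [set i in s1]| -> 2 * #|B1 :&: [set i in s1]| <= #|B1| ->
  exists A' B' : {set I}, [/\ A' \subset A1, B' \subset B1, N <= #|A'|, N <= #|B'|
    & pieces A' B' (a' + b').+1 (s1 ++ s2)].
  move=> lt dAB1 sA1 sB1 leA1 leB1 halfA halfB.
  case: a' => [|a'] in lt sA1 leA1 leB1 *.
    exists A1, B1; split=> //.
      + exact: leq_trans (le_pow _) leA1.
      + exact: leq_trans (le_pow _) leB1.
    apply: pieces1; apply/orP; left; apply/hasPn => i si; apply/negP => /sA1.
    by rewrite leqn0 => /eqP /count_memPn; rewrite si.
  rewrite addSn expnS -mulnA in leA1 leB1.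
  have eB := cardsID [set i in s1] B1.
  have [||||||A' [B' [sA' sB' NA NB AB']]] :=
    IHc a' b' (A1 :&: [set i in s1]) (B1 :\: [set i in s1]) s2.
  - by lia.
  - by apply: disjointWl (subsetIl _ _) _; apply: disjointWr (subsetDl _ _) _.
  - move=> i; rewrite !inE => /andP[/sA1 + is1].
    have : 0 < count_mem i s1 by rewrite -has_count has_pred1.
    by rewrite count_cat; lia.
  - by move=> i; rewrite !inE => /andP[_ /sB1]; rewrite count_cat; lia.
  - by lia.
  - by lia.
  exists A', B'; split=> //.
  - exact: subset_trans sA' (subsetIl _ _).
  - exact: subset_trans sB' (subsetDl _ _).
  exists s1, s2; split=> //; apply/orP; right; apply/hasPn => i is1.
  by apply/negP => /(subsetP sB'); rewrite !inE is1.
pose half (C : {set I}) p := #|C| <= 2 * #|C :&: [set i in take p s]|.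
(* If even the whole of [s] meets less than half of each set, the part of [A] outside [s] is large
   enough and one piece suffices. *)
case: (boolP (half A (size s) || half B (size s))) => [ex|]; last first.
  rewrite /half take_size negb_or -!ltnNge => /andP[ltA ltB].
  have eA := cardsID [set i in s] A.
  exists (A :\: [set i in s]), B; split=> //; rewrite ?subsetDl //.
  - have [ab0|ab0] := posnP (a + b).
      have A0 : A :&: [set i in s] = set0.
        apply/setP => i; rewrite !inE; apply/negP => /andP[/sA si is_].
        have : 0 < count_mem i s by rewrite -has_count has_pred1.
        by lia.
      by rewrite A0 cards0 in eA ltA; rewrite ab0 in leA; lia.
    by case: (a + b) ab0 leA => // k _; rewrite expnS; have := le_pow k; lia.
  - exact: leq_trans (le_pow _) leB.
  by apply: pieces1; apply/orP; left; apply/hasPn => i is_; rewrite /= !inE is_.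
have exP : exists p, half A p || half B p by exists (size s).
have [p Pp minp] := ex_minnP exP.
case: p => [|q] in Pp minp.
  have I0 (C : {set I}) : C :&: [set i in [::]] = set0.
    by apply/setP => i; rewrite !inE andbF.
  by move: Pp; rewrite /half !take0 !I0 cards0; have := le_pow (a + b); lia.
have lt_q : q < size s := minp _ ex.
have /norP[] : ~~ (half A q || half B q) by apply/negP => /minp; rewrite ltnn.
rewrite /half -!ltnNge => ltA ltB.
have i0 : I by case: (s) lt_q.
have takeS := take_nth i0 lt_q.
(* The last entry [e] of the shortest prefix lies in at most one set; the other set is met no more
   than before [e], hence by less than half. *)
set e := nth i0 _ q in takeS.
have eqI (C : {set I}) : e \notin C ->
    C :&: [set i in take q.+1 s] = C :&: [set i in take q s].
  move=> eC; apply/setP => i; rewrite !inE takeS mem_rcons inE.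
  by case: eqVneq => // ->; rewrite (negPf eC).
have nAB : ~~ ((e \in A) && (e \in B)).
  by apply/negP => /andP[eA eB]; rewrite (disjointFr dAB eA) in eB.
rewrite -(cat_take_drop q.+1 s) in sA sB *.
have [eA|eA] := boolP (e \in A).
  have eB : e \notin B by rewrite eA in nAB.
  move: Pp; rewrite /half (eqI B) // (leqNgt #|B|) ltB orbF => Pp.
  by apply: step => //; rewrite eqI // ltnW.
move: Pp; rewrite /half (eqI A) // (leqNgt #|A|) ltA orFb => Pp.
rewrite addnC in lt_abc leA leB *.
have dBA : [disjoint B & A] by rewrite disjoint_sym.
have hA : 2 * #|A :&: [set i in take q.+1 s]| <= #|A| by rewrite eqI // ltnW.
have [B' [A' [sB' sA' NB NA AB]]] := step _ _ _ _ _ _ lt_abc dBA sB sA leB leA Pp hA.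
by exists A', B'; split=> //; apply: piecesC.
Qed.

(** * Alternating protocols and hard functions *)

Fixpoint proto (V : Type) (m : nat) (X Y : Type) : Type :=
  if m is m'.+1 then ((V -> X -> V) * proto V m' Y X)%type else unit.

(** The last message is the only memory: each speaker sees it and its own input. Swapping [x] and
    [y] alternates the speakers. *)
Fixpoint proto_run (V : Type) (m : nat) (X Y : Type) :
    proto V m X Y -> V -> X -> Y -> V :=
  if m is m'.+1 then
    fun p v x y => proto_run (p : _ * proto V m' Y X).2 (p.1 v x) y x
  else fun _ v _ _ => v.

(* The player about to speak keeps inputs of density above 1/2, the other one
   above 3/4; after a message the speaker is brought back above 3/4, while the
   listener, about to speak, may fall to 1/2. *)
Definition hard (s m : nat) (X Y : finType) (f : X -> Y -> bool) : Prop :=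
  forall (V : finType) (P Q : Type) (p : proto V m P Q) (phi : X -> P)
    (psi : Y -> Q) (v : V) (out : V -> bool) (A : {set X}) (B : {set Y}),
  #|V| <= s -> #|X| < 2 * #|A| -> 3 * #|Y| < 4 * #|B| ->
  exists x y, [/\ x \in A, y \in B
                & out (proto_run p v (phi x) (psi y)) != f x y].

(** Without messages the output is constant, while a set of density above 1/2 in [bool] contains
    both values. *)
Lemma hard_bool s : hard s 0 (fun (x : bool) (_ : unit) => x).
Proof.
move=> V P Q p phi psi v out A B _; rewrite card_bool card_unit /= => leA leB.
have AT : A = setT by apply/eqP; rewrite eqEcard subsetT /= cardsT card_bool; lia.
exists (~~ out v), tt; rewrite AT inE; split=> //; last by case: (out v).
have /card_gt0P[[]//] : 0 < #|B| by rewrite lt0n; apply: contraTneq leB => ->.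
Qed.

Lemma card_fiber_ge (T V : finType) (h : T -> V) (A : {set T}) (s : nat) :
  #|V| <= s -> 0 < #|A| -> exists v, #|A| <= s * #|[set x in A | h x == v]|.
Proof.
move=> leV A_gt0; have [x0 x0A] := card_gt0P A_gt0.
pose c v := #|[set x in A | h x == v]|.
have [v _ vmax] := @arg_maxnP V (h x0) predT c isT; exists v.
have -> : #|A| = \sum_w c w.
  rewrite -sum1_card (partition_big h predT) //=; apply: eq_bigr => w _.
  by rewrite sum1dep_card /c cardsE.
apply: (@leq_trans (\sum_(w : V) c v)); first by apply: leq_sum => w _; apply: vmax.
by rewrite sum_nat_const leq_mul2r leV orbT.
Qed.

(** [A] lies in the product of its projections, and each projection in [G] costs a factor 3/4. *)
Lemma card_proj_le (I Y : finType) (A : {set {ffun I -> Y}}) (G : {set I}) :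
  {in G, forall i, 4 * #|[set x i | x : {ffun I -> Y} in A]| <= 3 * #|Y|} ->
  4 ^ #|G| * #|A| <= 3 ^ #|G| * #|Y| ^ #|I|.
Proof.
move=> small.
pose F i : {set Y} := if i \in G then [set x i | x : {ffun I -> Y} in A] else setT.
have leA : #|A| <= \prod_i #|F i|.
  have -> : \prod_i #|F i| = #|family F| by rewrite card_family foldrE big_map big_enum.
  apply/subset_leq_card/subsetP => x xA.
  by apply/familyP => i; rewrite /F; case: ifP => _; rewrite ?inE //; apply: imset_f.
apply: leq_trans (leq_mul (leqnn _) leA) _.
have expE k : k ^ #|G| = \prod_(i : I) (if i \in G then k else 1).
  by rewrite -big_mkcond prod_nat_const.
rewrite !expE -prod_nat_const -!big_split /=; apply: leq_prod => i _.
by rewrite /F; case: ifP => [/small//|]; rewrite !mul1n cardsT.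
Qed.

(** The most frequent first message [w] leaves a set [Aw] of density above 1/(2s). More than half of
    the coordinates [i] have a slice [Bi i] of density above 1/2. If [Aw] had projections of density
    at most 3/4 on all of these, its density would be at most (3/4)^(3L) <= 2^(-L) <= 1/(2s). *)
Lemma hard_step (s m L : nat) (X Y : finType) (f : X -> Y -> bool) :
  2 * s <= 2 ^ L -> hard s m f ->
  hard s m.+1 (fun (x : {ffun 'I_(6 * L) -> Y}) (y : 'I_(6 * L) * X) => f y.2 (x y.1)).
Proof.
move=> le_s hf V P Q [h p] phi psi v out A B leV leA leB.
set t := 6 * L in A B phi psi leA leB *.
rewrite card_ffun card_ord in leA; rewrite card_prod card_ord in leB.
have [|w lew] := card_fiber_ge (fun x => h v (phi x)) leV (_ : 0 < #|A|); first by lia.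
set Aw := [set x in A | _] in lew.
pose Bi i := [set x | (i, x) \in B].
pose G := [set i : 'I_t | #|X| < 2 * #|Bi i|].
have cardB : #|B| = \sum_(i : 'I_t) #|Bi i|.
  transitivity (\sum_(i : 'I_t) \sum_(x | (i, x) \in B) 1).
    by rewrite pair_big_dep /= -sum1_card; apply: eq_bigl => -[].
  by apply: eq_bigr => i _; rewrite sum1dep_card /Bi cardsE.
(* Averaging: a slice outside [G] has density at most 1/2 and any other at most 1, yet the mean
   density exceeds 3/4. *)
have leG : t < 2 * #|G|.
  have : 2 * #|B| <= #|X| * (t + #|G|).
    have -> : #|X| * (t + #|G|) = \sum_(i : 'I_t) (#|X| + if i \in G then #|X| else 0).
      by rewrite big_split -big_mkcond /= !sum_nat_const card_ord mulnC mulnDl.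
    rewrite cardB big_distrr /=.
    have aux (c d : nat) : c <= d -> 2 * c <= d + (if d < 2 * c then d else 0).
      by case: (ltnP d) => /=; lia.
    by apply: leq_sum => i _; rewrite inE; apply/aux/max_card.
  by move: (#|B|) (#|X|) (#|G|) leB => b x g; nia.
have [i iG big_i] : exists2 i, i \in G &
    3 * #|Y| < 4 * #|[set x i | x : {ffun 'I_t -> Y} in Aw]|.
  apply/exists_inP; apply: contraT; rewrite negb_exists_in => /forall_inP small.
  have le4 : 4 ^ #|G| * #|Aw| <= 3 ^ #|G| * #|Y| ^ #|'I_t|.
    by apply: card_proj_le => i /small; rewrite -leqNgt.
  rewrite card_ord in le4.
  have [e eG] : exists e, #|G| = 3 * L + e by exists (#|G| - 3 * L); lia.
  (* As 2 * 3^3 <= 4^3, every three coordinates gain a factor 2. *)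
  have le27 : 3 ^ #|G| * (2 * s) <= 4 ^ #|G|.
    rewrite eG (expnD 3 (3 * L)) (expnD 4 (3 * L)) !(expnM _ 3).
    have le1 : 3 ^ e <= 4 ^ e by case: (e) => // e'; rewrite leq_exp2r.
    apply: leq_trans (_ : 27 ^ L * 2 ^ L * 3 ^ e <= _).
      by rewrite mulnAC !leq_mul.
    by rewrite -expnMn; apply: leq_mul => //; case: (L) => // l; rewrite leq_exp2r.
  have : 4 ^ #|G| * #|Aw| < 4 ^ #|G| * #|Aw|; last by rewrite ltnn.
  have p3 : 0 < 3 ^ #|G| by rewrite expn_gt0.
  apply: leq_ltn_trans le4 _; apply: leq_trans (_ : 3 ^ #|G| * (2 * s * #|Aw|) <= _).
    by rewrite ltn_pmul2l // -mulnA (leq_trans leA) // leq_mul2l lew orbT.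
  by rewrite mulnA leq_mul2r le27 orbT.
set S := [set x i | x : {ffun 'I_t -> Y} in Aw] in big_i.
have [x0 _] : exists x0, x0 \in Aw.
  by apply/set0Pn; apply/eqP => Aw0; rewrite /S Aw0 imset0 cards0 in big_i.
(* [g y] extends a value [y] at coordinate [i] to a full input in [Aw]; the default [x0] is not
   reached for [y] in [S]. *)
pose g y := odflt x0 [pick x in Aw | x i == y].
have gP y : y \in S -> g y \in Aw /\ g y i = y.
  case/imsetP => x xA ->; rewrite /g; case: pickP => [z /andP[zA /eqP]//|/(_ x)].
  by rewrite xA eqxx.
(* The remaining protocol is played for [f] with the roles exchanged, its inputs read through
   [(i, x)] and [g y]; the maps [phi] and [psi] in [hard] allow this. *)
have [|x [y [xB /gP[gA gi] neq]]] := hf V Q P p (fun x => psi (i, x)) (phi \o g) w out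
   (Bi i) S leV _ big_i; first by rewrite inE in iG.
exists (g y), (i, x); split; first by rewrite inE in gA; case/andP: gA.
- by rewrite inE in xB.
by move: gA; rewrite inE /= gi => /andP[_ /eqP ->].
Qed.

(** * Encoding hard inputs by order statistics *)

Lemma nth_sort_cat (s lo mid hi : seq nat) K :
  perm_eq s (lo ++ mid ++ hi) -> allrel leq lo mid -> allrel leq mid hi ->
  allrel leq lo hi -> K < size mid ->
  nth 0 (sort leq s) (size lo + K) = nth 0 (sort leq mid) K.
Proof.
move=> eq_s lomid midhi lohi ltK.
have allS (r : rel nat) u w : allrel r (sort leq u) (sort leq w) = allrel r u w.
  rewrite /allrel (perm_all _ (permEl (perm_sort _ _))); apply: eq_all => x /=.
  by rewrite (perm_all _ (permEl (perm_sort _ _))).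
have -> : sort leq s = sort leq lo ++ sort leq mid ++ sort leq hi.
  apply: (sorted_eq leq_trans anti_leq); first exact: sort_sorted leq_total _.
    rewrite sorted_pairwise; last exact: leq_trans.
    rewrite !pairwise_cat allrel_catr !allS lomid lohi midhi /=.
    by rewrite -!sorted_pairwise ?(sort_sorted leq_total) //; apply: leq_trans.
  rewrite perm_sort (perm_trans eq_s) // perm_sym.
  by do 2?apply: perm_cat; rewrite perm_sort.
by rewrite !nth_cat !size_sort ltnNge leq_addr addKn ltK.
Qed.

Lemma nth_sort_shift (c : nat) (s : seq nat) K : K < size s ->
  nth 0 (sort leq [seq c + z | z <- s]) K = c + nth 0 (sort leq s) K.
Proof.
move=> ltK; rewrite -(nth_map 0 0) ?size_sort //; congr (nth _ _ _).
apply: (sorted_eq leq_trans anti_leq); first exact: sort_sorted leq_total _.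
  apply: homo_sorted (sort_sorted leq_total s) => x y /=.
  by rewrite leq_add2l.
by rewrite perm_sort perm_map // perm_sym perm_sort.
Qed.

(** Lengths and rank are the same for all inputs, so fixed positions of the program's input can
    carry the values. *)
Definition encodes (X Y : finType) (f : X -> Y -> bool) (a b K v : nat)
    (eX : X -> seq nat) (eY : Y -> seq nat) : Prop :=
  [/\ K < a + b,
      forall x, size (eX x) = a /\ {in eX x, forall z, z <= v},
      forall y, size (eY y) = b /\ {in eY y, forall z, z <= v} &
      forall x y, f x y = odd (nth 0 (sort leq (eX x ++ eY y)) K)].

(* The evenness of [v] makes the shift by [i * v] preserve parities. *)
Lemma encodes_step (t : nat) (X Y : finType) (f : X -> Y -> bool)
    (a b K v : nat) (eX : X -> seq nat) (eY : Y -> seq nat) :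
  0 < t -> ~~ odd v -> encodes f a b K v eX eY ->
  encodes (fun (x : {ffun 'I_t -> Y}) (y : 'I_t * X) => f y.2 (x y.1))
    (t * b) (a + b * t.-1) (b * t.-1 + K) (t * v)
    (fun x => flatten [seq [seq j * v + z | z <- eY (x j)] | j : 'I_t <- enum 'I_t])
    (fun y => [seq y.1 * v + z | z <- eX y.2] ++
              nseq (b * (t.-1 - y.1)) 0 ++ nseq (b * y.1) (t * v)).
Proof.
move=> t_gt0 v_even [ltK eXP eYP fP].
have sizeY (x : {ffun 'I_t -> Y}) (r : seq 'I_t) :
    size (flatten [seq [seq j * v + z | z <- eY (x j)] | j : 'I_t <- r]) = size r * b.
  by elim: r => //= j r IHr; rewrite size_cat IHr size_map (eYP _).1 mulSn.
have blockP (e : seq nat) j z : {in e, forall z, z <= v} ->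
    z \in [seq j * v + z | z <- e] -> j * v <= z <= j.+1 * v.
  by move=> ev /mapP[z0 /ev le0 ->]; rewrite mulSn; lia.
have blocksP (x : {ffun 'I_t -> Y}) (r : seq 'I_t) z :
    z \in flatten [seq [seq j * v + z | z <- eY (x j)] | j : 'I_t <- r] ->
    exists2 j, j \in r & j * v <= z <= j.+1 * v.
  case/flattenP => s /mapP[j jr ->] zs; exists j => //.
  by apply: blockP zs; apply: (eYP _).2.
have lt_le (i j : nat) : i < j -> i.+1 * v <= j * v by move=> ij; rewrite leq_mul2r ij orbT.
split.
- by case: (t) t_gt0 => // t' _ /=; lia.
- move=> x; rewrite sizeY size_enum_ord; split=> // z /blocksP[j _ /andP[_ /leq_trans->]] //.
  exact: lt_le.
- case=> i x; split=> [|z]; rewrite /= ?mem_cat ?size_cat ?size_map ?size_nseq.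
    by rewrite (eXP _).1 -mulnDr subnK // -ltnS prednK.
  case/or3P => [/(blockP _ _ _ (eXP _).2)/andP[_ /leq_trans->] //||].
  + exact: lt_le.
  + by move/nseqP => [->].
  + by move/nseqP => [->].
move=> x [i x'] /=; rewrite fP.
pose block (j : 'I_t) := [seq j * v + z | z <- eY (x j)].
pose lo := flatten [seq block j | j : 'I_t <- [seq j : 'I_t <- enum 'I_t | j < i]].
pose hi := flatten [seq block j | j : 'I_t <- [seq j : 'I_t <- enum 'I_t | i < j]].
(* Below block [i] lie [i] blocks and as many zeros as [t.-1 - i] blocks have entries. The total
   does not depend on [i], so one rank serves every choice of the listener. *)
have size_lo : size (lo ++ nseq (b * (t.-1 - i)) 0) = b * t.-1.
  rewrite size_cat sizeY size_nseq size_filter.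
  rewrite -(count_map val (fun j => j < i)) val_enum_ord -size_filter.
  rewrite (_ : [seq j <- iota 0 t | j < i] = iota 0 i); last first.
    by rewrite -[in RHS](filter_iota_ltn 0 (ltnW (ltn_ord i))).
  by rewrite size_iota mulnC -mulnDr subnKC // -ltnS prednK.
rewrite -size_lo (@nth_sort_cat _ (lo ++ nseq (b * (t.-1 - i)) 0)
  [seq i * v + z | z <- eX x' ++ eY (x i)] (hi ++ nseq (b * i) (t * v))).
- by rewrite nth_sort_shift ?oddD ?oddM ?(negPf v_even) ?andbF // size_cat (eXP _).1 (eYP _).1.
- have perm_enum : perm_eq (enum 'I_t)
      ([seq j : 'I_t <- enum 'I_t | j < i] ++ i :: [seq j : 'I_t <- enum 'I_t | i < j]).
    apply: uniq_perm; first exact: enum_uniq.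
      rewrite cat_uniq cons_uniq !(filter_uniq _ (enum_uniq _)) /= negb_or.
      rewrite !mem_filter !ltnn /= andbT.
      apply/hasPn => j; rewrite !mem_filter => /andP[ij _] /=.
      by rewrite ltnNge ltnW.
    move=> j; rewrite mem_cat inE !(mem_filter _ _ (enum _)) !mem_enum !andbT.
    by case: ltngtP => [||/val_inj ->]; rewrite ?orbT ?eqxx ?inE.
  have eqf : perm_eq (flatten [seq block j | j <- enum 'I_t]) (lo ++ block i ++ hi).
    rewrite /lo /hi -[block i ++ _]/
      (flatten [seq block j | j <- i :: [seq j : 'I_t <- enum 'I_t | i < j]]).
    by rewrite -flatten_cat -map_cat perm_flatten ?perm_map.
  apply/permP => q; rewrite map_cat !count_cat (permP eqf) !count_cat /block; lia.
- apply/allrelP => z w; rewrite mem_cat => /orP[|/nseqP[-> _]//].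
  case/blocksP => j; rewrite mem_filter => /andP[ij _] /andP[_ le1].
  rewrite map_cat mem_cat => wP; have /andP[le2 _] : i * v <= w <= i.+1 * v.
    by case/orP: wP; apply: blockP; [apply: (eXP _).2|apply: (eYP _).2].
  by rewrite (leq_trans le1) // (leq_trans _ le2) // lt_le.
- apply/allrelP => z w zP; have /andP[_ le2] : i * v <= z <= i.+1 * v.
    by move: zP; rewrite map_cat mem_cat => /orP[]; apply: blockP;
      [apply: (eXP _).2|apply: (eYP _).2].
  rewrite mem_cat => /orP[/blocksP[j]|/nseqP[-> _]]; last exact: leq_trans le2 (lt_le _ _ _).
  rewrite mem_filter => /andP[ij _] /andP[le1 _].
  exact: leq_trans le2 (leq_trans (lt_le _ _ ij) le1).
- apply/allrelP => z w; rewrite mem_cat => /orP[/blocksP[j]|/nseqP[-> _]//].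
  rewrite mem_filter => /andP[ij _] /andP[_ le1].
  rewrite mem_cat => /orP[/blocksP[l]|/nseqP[-> _]]; last exact: leq_trans le1 (lt_le _ _ _).
  rewrite mem_filter => /andP[il _] /andP[le2 _].
  by apply: leq_trans le1 (leq_trans (lt_le _ _ (ltn_trans ij il)) le2).
by rewrite size_map size_cat (eXP _).1 (eYP _).1.
Qed.

(** Each round uses t = 6L, so it multiplies the number of values by at most 2t = 12L and their
    bound by 6L. *)
Lemma hard_median (s m L : nat) : 0 < L -> 2 * s <= 2 ^ L ->
  exists (X Y : finType) (f : X -> Y -> bool) (a b K v : nat)
    (eX : X -> seq nat) (eY : Y -> seq nat),
    [/\ hard s m f, encodes f a b K v eX eY, ~~ odd v,
        a + b <= (12 * L) ^ m & v <= 2 * (12 * L) ^ m] /\ 0 < #|X| /\ 0 < #|Y|.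
Proof.
move=> L_gt0 le_s.
elim: m => [|m [X [Y [f [a [b [K [v [eX [eY [[hf enc v_even leab lev] [X0 Y0]]]]]]]]]]]].
  (* The values are at most 1; the bound 2 is chosen to be even. *)
  exists bool, unit, (fun x _ => x), 1, 0, 0, 2, (fun x : bool => [:: x : nat]), (fun=> [::]).
  rewrite card_bool card_unit; split=> //; split=> //; first exact: hard_bool.
  split=> // [x|x y]; last by case: x.
  by split=> // z; rewrite inE => /eqP ->; case: x.
have t_gt0 : 0 < 6 * L by lia.
exists {ffun 'I_(6 * L) -> Y}, ('I_(6 * L) * X)%type; do 7 eexists; split; last first.
  by rewrite card_ffun card_prod card_ord expn_gt0 Y0 muln_gt0 t_gt0.
split; [exact: hard_step le_s hf | exact: encodes_step enc| | |].
- by rewrite oddM (negPf v_even) andbF.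
- rewrite expnS; apply: leq_trans (_ : 12 * L * (a + b) <= _); last by rewrite leq_mul2l leab orbT.
  by nia.
by rewrite expnS; nia.
Qed.

(** * Runs of an oblivious program *)

Lemma bp_path_uniq (n : nat) (D : finType) (O : Type) (P : bp_graph n D O) v p :
  bp_acyclic P -> path (@bp_edge n D O P) v p -> uniq (v :: p).
Proof.
move=> acyc; elim: p v => //= u p IHp v /andP[vu up]; rewrite IHp // andbT.
apply/negP => /(path_connect up) => uv.
by have /negP := acyc _ _ vu; apply.
Qed.

Lemma bp_trace_path (n : nat) (D : finType) (O : Type) (P : bp_graph n D O) v w :
  @bp_trace n D O P v w -> exists2 p, path (@bp_edge n D O P) v p & size p = size w.
Proof.
elim: w v => [|a w IHw] v /=; first by exists [::].
case E: (bp_node_kind v) => [//|[i succ]] /=.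
case: (bp_trace (succ a) w) (IHw (succ a)) => //= _ [//|p up sp] _.
exists (succ a :: p); rewrite /= ?sp // up andbT /bp_edge E.
by apply/existsP; exists a.
Qed.

(** By acyclicity the nodes of a path are distinct, so the range [t < bp_size] in [bp_length] misses
    no trace. *)
Lemma bp_trace_length (n : nat) (D : finType) (O : Type)
    (P : branching_program n D O) w :
  bp_trace (bp_source P) w -> size w <= bp_length P.
Proof.
move=> tw; have [p sp pw] := bp_trace_path tw.
have ltw : size w < bp_size P.
  have := bp_path_uniq (@bp_acyclicP _ _ _ P) sp.
  by move=> /card_uniqP; rewrite /= -pw => <-; apply: max_card.
rewrite /bp_length (bigop.bigmax_sup (Ordinal ltw)) //=.
by apply/existsP; exists (in_tuple w).
Qed.

(** The value read is an argument, so that either player can supply it; sinks are fixed, so that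
    runs are total. *)
Definition bp_move (n : nat) (D : finType) (O : Type) (P : bp_graph n D O)
    (v : bp_node P) (d : D) : bp_node P :=
  if bp_node_kind v is inr (_, succ) then succ d else v.

Definition bp_run (n : nat) (D : finType) (O : Type) (P : bp_graph n D O)
    (x : 'I_n -> D) : bp_node P -> seq 'I_n -> bp_node P :=
  foldl (fun v i => bp_move v (x i)).

Lemma bp_outputs_run (n : nat) (D : finType) (O : Type) (P : bp_graph n D O)
    (x : n.-tuple D) (v : bp_node P) (t : nat) (o : O) :
  bp_node_kind (iter t (bp_step x) v) = inl o ->
  exists2 s, bp_trace v (map (tnth x) s) = Some s &
    bp_node_kind (bp_run (tnth x) v s) = inl o.
Proof.
elim: t v => [|t IHt] v; first by move=> /= vo; exists [::]; rewrite //= vo.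
rewrite iterSr => /IHt[s]; rewrite /bp_step.
case E: (bp_node_kind v) => [ o1|[i succ]] ts so; first by exists s.
by exists (i :: s); rewrite /= ?E /= ?ts // /bp_move E.
Qed.

(** By obliviousness, the indices queried on one constant input are those queried on every input. *)
Lemma oblivious_run (n : nat) (D : finType) (O : Type)
    (P : branching_program n D O) (f : n.-tuple D -> O) (d : D) :
  bp_oblivious P -> bp_computes P f ->
  exists2 s : seq 'I_n, size s <= bp_length P &
    forall x, bp_node_kind (bp_run (tnth x) (bp_source P) s) = inl (f x).
Proof.
move=> obl comp; have runs x : exists2 s, bp_trace (bp_source P) (map (tnth x) s) = Some s &
    bp_node_kind (bp_run (tnth x) (bp_source P) s) = inl (f x).
  by have [t xt] := comp x; apply: bp_outputs_run xt.
have [s ts _] := runs (nseq_tuple n d).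
exists s; first by rewrite -(size_map (tnth (nseq_tuple n d))) bp_trace_length ?ts.
by move=> x; have [s' ts' s'o] := runs x; rewrite (obl _ _ _ _ ts ts').
Qed.

(* Rounds of a protocol alternate strictly, so each piece is given two rounds,
   in one of which the state is left unchanged. *)
Lemma pieces_proto (I : finType) (D V : Type) (st : V -> D -> V)
    (A B : {set I}) (c : nat) (s : seq I) :
  pieces A B c s ->
  exists p : proto V c.*2 (I -> D) (I -> D), forall v (xA xB x : I -> D),
    (forall i, i \notin B -> x i = xA i) -> (forall i, i \notin A -> x i = xB i) ->
    proto_run p v xA xB = foldl (fun v i => st v (x i)) v s.
Proof.
have foldE (C : {set I}) s1 v (x y : I -> D) : ~~ has (mem C) s1 ->
    (forall i, i \notin C -> x i = y i) ->
    foldl (fun v i => st v (x i)) v s1 = foldl (fun v i => st v (y i)) v s1.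
  move=> s1C xy; elim: s1 v s1C => //= i s1 IHs v; rewrite negb_or => /andP[iC /IHs ->].
  by rewrite xy.
pose go v (x : I -> D) s1 := foldl (fun v i => st v (x i)) v s1.
elim: c s => [|c IHc] s /=; first by move=> ->; exists tt.
move=> [s1 [s2 [-> s1AB /IHc[p pP]]]].
case/orP: s1AB => s1C.
  exists (fun v _ => v, (fun v x => go v x s1, p)) => v xA xB x xAP xBP /=.
  by rewrite (pP _ _ _ _ xAP xBP) foldl_cat (foldE _ _ _ _ _ s1C xBP).
exists (fun v x => go v x s1, (fun v _ => v, p)) => v xA xB x xAP xBP /=.
by rewrite (pP _ _ _ _ xAP xBP) foldl_cat (foldE _ _ _ _ _ s1C xAP).
Qed.

(** * From an oblivious program to a protocol for the median *)

Lemma subset_of_card (T : finType) (Z : {set T}) k :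
  k <= #|Z| -> exists2 A : {set T}, A \subset Z & #|A| = k.
Proof.
move=> lek; exists [set x in take k (enum Z)].
  by apply/fintype.subsetP => x; rewrite inE => /mem_take; rewrite mem_enum.
by rewrite cardsE (card_uniqP _) ?take_uniq ?enum_uniq // size_takel // -cardE.
Qed.

Lemma sum_count_mem (T : finType) (s : seq T) : \sum_i count_mem i s = size s.
Proof.
elim: s => [|x s IHs] /=; first by rewrite big1.
rewrite big_split /= IHs (bigD1 x) //= eqxx big1 ?addn0 // => i.
by rewrite eq_sym => /negPf ->.
Qed.

(** Markov's inequality: each remaining element takes at least [M.+1] positions of [s]. *)
Lemma card_few_occurrences (T : finType) (s : seq T) M :
  2 * size s < M.+1 * #|T| -> #|T| < 2 * #|[set i | count_mem i s <= M]|.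
Proof.
move=> le_s; have eC := cardsC [set i | count_mem i s <= M].
have : #|~: [set i | count_mem i s <= M]| * M.+1 <= size s.
  rewrite -sum_count_mem -sum_nat_const big_mkcond /=; apply: leq_sum => i _.
  by rewrite !inE -ltnNge; case: ltnP.
move: eC le_s; move: #|~: _| #|[set i | _]| #|T| => p q t; nia.
Qed.

Lemma map_nth_index (T : eqType) (S : Type) (z : S) (e : seq T) (l : seq S) :
  uniq e -> size e = size l -> [seq nth z l (index i e) | i <- e] = l.
Proof.
move=> ue el; case: e => [|x0 e] in ue el *; first by case: l el.
apply: (@eq_from_nth _ z) => [|j]; rewrite size_map // => lt_j.
by rewrite (nth_map x0) // index_uniq.
Qed.

(** The [lo] small values lift rank [K] of [mid] to the middle rank. The successors come from the
    ordinal i standing for i + 1. *)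
Lemma median_padded (mid : seq nat) (lo hi K v : nat) (s : seq nat) :
  {in mid, forall z, z <= v} -> K < size mid ->
  lo + K = (lo + size mid + hi)./2 ->
  perm_eq s [seq z.+1 | z <- mid ++ nseq lo 0 ++ nseq hi v] ->
  median s = (nth 0 (sort leq mid) K).+1.
Proof.
move=> le_v ltK half eq_s; rewrite /median (perm_size eq_s).
rewrite size_map !size_cat !size_nseq addnCA addnA -half.
rewrite -[X in X + K](size_nseq lo 1).
rewrite (@nth_sort_cat _ _ [seq 1 + z | z <- mid] (nseq hi v.+1)).
- exact: nth_sort_shift.
- apply: perm_trans eq_s _; rewrite !map_cat !map_nseq perm_catCA.
  exact: perm_refl.
- by apply/allrelP => z w /nseqP[-> _] /mapP[w' _ ->].
- by apply/allrelP => z w /mapP[z' /le_v + ->] /nseqP[-> _].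
- by apply/allrelP => z w /nseqP[-> _] /nseqP[-> _].
by rewrite size_map.
Qed.

(** For larger [n], the inputs queried at most [M] times would contain two sets on which the program
    yields a protocol too short for the function of [hard_median]. *)
Lemma oblivious_median_bound (n M L : nat)
    (P : branching_program n 'I_(2 * n) bool) :
  bp_oblivious P -> bp_computes P (@median_low_bit n) ->
  2 * bp_length P < M.+1 * n -> 0 < L -> 2 * bp_size P <= 2 ^ L ->
  n < 2 ^ (M + M) * (8 * (12 * L) ^ (M + M).+1.*2).
Proof.
move=> obl comp leT L_gt0 leS; rewrite ltnNge; apply/negP => le_n.
set m := (M + M).+1.*2 in le_n.
have [X [Y [f [a [b [K [v [eX [eY [[hf [ltK eXP eYP fP] _ leab lev] [X0 Y0]]]]]]]]]]] :=
  hard_median m L_gt0 leS.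
have W_gt0 : 0 < (12 * L) ^ m by rewrite expn_gt0 muln_gt0 L_gt0.
set W := (12 * L) ^ m in le_n leab lev W_gt0.
have p2_gt0 : 0 < 2 ^ (M + M) by rewrite expn_gt0.
have leWn : 8 * W <= n by apply: leq_trans le_n; rewrite leq_pmull.
have n2_gt0 : 0 < 2 * n by lia.
(* With [q] indices on each side, [M + M] halvings still leave [W], which is enough for the [a + b]
   values. *)
have [q qE] : {q | q = 2 ^ (M + M) * W} by exists (2 ^ (M + M) * W).
have le_q : 8 * q <= n by rewrite qE mulnCA.
pose d0 : 'I_(2 * n) := Ordinal n2_gt0.
have [s le_s runP] := oblivious_run d0 obl comp.
pose Z := [set i | count_mem i s <= M].
have leZ : n < 2 * #|Z|.
  have := @card_few_occurrences 'I_n s M; rewrite card_ord; apply.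
  by apply: leq_ltn_trans leT; rewrite leq_mul2l le_s orbT.
have leZ2 : q + q <= #|Z|.
  by rewrite -(leq_pmul2l (isT : 0 < 2)); apply: leq_trans (ltnW leZ); lia.
have [A sAZ cA] : exists2 A : {set 'I_n}, A \subset Z & #|A| = q.
  by apply: subset_of_card; apply: leq_trans leZ2; apply: leq_addr.
have [B sBZ cB] : exists2 B : {set 'I_n}, B \subset Z :\: A & #|B| = q.
  by apply: subset_of_card; rewrite cardsDS // cA leq_subRL // (leq_trans _ leZ2) // leq_addr.
have dAB : [disjoint A & B].
  rewrite disjoint_sym finset.disjoints_subset; apply: fintype.subset_trans sBZ _.
  exact: finset.subsetDr.
have fewZ : {in Z, forall i, count_mem i s <= M} by move=> i; rewrite inE.
have [A' [B' [sA' sB' leA leB ABs]]] : exists A' B' : {set 'I_n},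
    [/\ A' \subset A, B' \subset B, W <= #|A'|, W <= #|B'| & pieces A' B' (M + M).+1 s].
  apply: alon_maass => //; rewrite -?qE ?cA ?cB //.
    by move=> i /(fintype.subsetP sAZ)/fewZ.
  by move=> i /(fintype.subsetP sBZ); rewrite inE => /andP[_ /fewZ].
have {}dAB : [disjoint A' & B'] by apply: disjointWl sA' (disjointWr sB' dAB).
have [p pP] := pieces_proto (@bp_move n 'I_(2 * n) bool P) ABs.
pose sA := take a (enum A'); pose sB := take b (enum B').
have size_sA : size sA = a by rewrite size_takel // -cardE; lia.
have size_sB : size sB = b by rewrite size_takel // -cardE; lia.
have sAP i : i \in sA -> i \in A' by move/mem_take; rewrite mem_enum.
have sBP i : i \in sB -> i \in B' by move/mem_take; rewrite mem_enum.
pose e := sA ++ sB ++ [seq i <- enum 'I_n | i \notin sA ++ sB].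
(* [e] lists first the positions of the first player's values, then those of the second player's,
   then those of the padding. *)
have ue : uniq e.
  rewrite /e catA cat_uniq cat_uniq !take_uniq ?enum_uniq // filter_uniq ?enum_uniq //= !andbT.
  apply/andP; split.
    by apply/hasPn => i /sBP iB; apply/negP => /sAP iA; rewrite (disjointFr dAB iA) in iB.
  by apply/hasPn => i; rewrite mem_filter => /andP[].
have pe : perm_eq (enum 'I_n) e.
  apply: uniq_perm; rewrite ?enum_uniq // => i.
  by rewrite /e catA mem_cat (mem_filter _ _ (enum _)) mem_enum andbT orbN.
have size_e : size e = n by rewrite -(perm_size pe) size_enum_ord.
pose lo := n./2 - K; pose hi := n - (lo + (a + b)).
have n_half : n = (odd n : nat) + n./2.*2 by rewrite odd_double_half.
pose fill (u w : seq nat) (i : 'I_n) : 'I_(2 * n) :=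
  insubd d0 (nth 0 ((u ++ w) ++ nseq lo 0 ++ nseq hi v) (index i e)).
(* Off [B'] the input is known to the owner of [A']; the zeros standing for the unknown list only
   keep its length. *)
have fillA x y i : i \notin B' -> fill (eX x) (eY y) i = fill (eX x) (nseq b 0) i.
  move=> iB; congr insubd; rewrite -!catA !nth_cat (eXP x).1 (eYP y).1 !size_nseq.
  rewrite {1 2 3}/e !index_cat.
  case: (boolP (i \in sA)) => [iA|iA]; first by rewrite -size_sA index_mem iA.
  by rewrite (negPf (contra (@sBP i) iB)) size_sA size_sB !ltnNge leq_addr addKn leq_addr.
have fillB x y i : i \notin A' -> fill (eX x) (eY y) i = fill (nseq a 0) (eY y) i.
  move=> iA; congr insubd; rewrite -!catA !nth_cat (eXP x).1 !size_nseq.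
  by rewrite {1 2}/e !index_cat (negPf (contra (@sAP i) iA)) size_sA !ltnNge leq_addr.
have XT : #|X| < 2 * #|[set: X]| by rewrite cardsT; lia.
have YT : 3 * #|Y| < 4 * #|[set: Y]| by rewrite cardsT; lia.
have [x [y [_ _ neq]]] := hf _ _ _ p (fun x => fill (eX x) (nseq b 0))
  (fun y => fill (nseq a 0) (eY y)) (bp_source P)
  (* The output is negated because the median is one more than the encoded value. *)
  (fun w => if bp_node_kind w is inl o then ~~ o else false) _ _ (leqnn _) XT YT.
move: neq; rewrite (pP _ _ _ (fill (eX x) (eY y))); last 2 first.
- exact: fillA.
- exact: fillB.
pose xt := [tuple fill (eX x) (eY y) i | i < n].
have := runP xt; rewrite /bp_run.
have -> : tnth xt = fill (eX x) (eY y) by apply/funext => i; rewrite tnth_mktuple.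
move=> ->; rewrite /median_low_bit.
have mid_le : {in eX x ++ eY y, forall z, z <= v}.
  by move=> z; rewrite mem_cat => /orP[/(eXP x).2|/(eYP y).2].
have size_mid : size (eX x ++ eY y) = a + b by rewrite size_cat (eXP x).1 (eYP y).1.
rewrite (@median_padded (eX x ++ eY y) lo hi K v) ?size_mid //=.
- by rewrite -fP negbK eqxx.
- have -> : lo + (a + b) + hi = n by lia.
  by rewrite subnK; lia.
rewrite (_ : [seq (val i).+1 | i <- xt] =
  [seq (val (fill (eX x) (eY y) i)).+1 | i <- enum 'I_n]); last first.
  by rewrite -map_comp.
apply: perm_trans (perm_map _ pe) _.
rewrite (_ : [seq _ | i <- e] = [seq z.+1 | z <- (eX x ++ eY y) ++ nseq lo 0 ++ nseq hi v]) //.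
rewrite -[in RHS](@map_nth_index _ _ 0 e ((eX x ++ eY y) ++ nseq lo 0 ++ nseq hi v)) //; last first.
  by rewrite size_e size_cat size_mid size_cat !size_nseq; lia.
(* All entries are at most [v], which is below [2 * n], so [insubd] does not fall back on [d0]. *)
rewrite -map_comp; apply: eq_map => i /=; rewrite val_insubd; case: ifP => //.
move=> /negP[]; have : nth 0 ((eX x ++ eY y) ++ nseq lo 0 ++ nseq hi v) (index i e) <= v; last first.
  by move/leq_ltn_trans; apply; lia.
have: all (leq^~ v) ((eX x ++ eY y) ++ nseq lo 0 ++ nseq hi v).
  apply/allP => z; rewrite mem_cat => /orP[/mid_le//|].
  by rewrite mem_cat => /orP[]/nseqP[->].
move: (_ ++ nseq lo 0 ++ _) => l /(all_nthP 0) le_l.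
by case: (ltnP (index i e) (size l)) => [/le_l//|/(nth_default 0) ->].
Qed.

(** Constant inputs produce both answers, which a single node cannot do. This later gives a
    logarithm of the size at least 1. *)
Lemma bp_size_gt1 (n : nat) (P : branching_program n 'I_(2 * n) bool) :
  0 < n -> bp_computes P (@median_low_bit n) -> 1 < bp_size P.
Proof.
move=> n_gt0 comp; rewrite ltnNge; apply/negP => le1.
have allP (u v : bp_node P) : u = v by apply: (fintype_le1P le1).
have kindP (x : n.-tuple 'I_(2 * n)) : bp_node_kind (bp_source P) = inl (median_low_bit x).
  by have [t] := comp x; rewrite (allP (iter _ _ _) (bp_source P)).
have constP (d : 'I_(2 * n)) : median_low_bit (nseq_tuple n d) = odd d.+1.
  rewrite /median_low_bit /median map_nseq size_nseq; congr odd.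
  have /(all_nthP 0) H : all (pred1 d.+1) (sort leq (nseq n d.+1)).
    by rewrite all_sort all_pred1_nseq.
  by apply/eqP/(H); rewrite size_sort size_nseq ltn_half_double -addnn; lia.
have lt0 : 0 < 2 * n by lia.
have lt1 : 1 < 2 * n by lia.
have := kindP (nseq_tuple n (Ordinal lt0)).
by rewrite (kindP (nseq_tuple n (Ordinal lt1))) !constP.
Qed.

Lemma oblivious_median_exp_bound (n M : nat)
    (P : branching_program n 'I_(2 * n) bool) :
  bp_oblivious P -> bp_computes P (@median_low_bit n) ->
  2 * bp_length P < M.+1 * n ->
  n <= (48 * (up_log 2 (bp_size P)).+1) ^ (4 * M + 2).
Proof.
move=> obl comp leT; set L := (up_log 2 _).+1.
have leS : 2 * bp_size P <= 2 ^ L by rewrite expnS leq_mul2l up_logP.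
have := oblivious_median_bound obl comp leT (ltn0Sn _ : 0 < L) leS.
have -> : (M + M).+1.*2 = 4 * M + 2 by lia.
move=> /ltnW/leq_trans; apply.
(* The factor 4^(4M+2) absorbs 2^(2M) * 8. *)
have -> : 48 * L = 4 * (12 * L) by lia.
rewrite (expnMn 4) mulnA leq_mul2r; apply/orP; right.
by rewrite -(expnM 2 2) -(expnD 2 _ 3) leq_exp2l //; lia.
Qed.

Local Open Scope classical_set_scope.
Local Open Scope ring_scope.

(** * Estimates over the reals *)

Section RealBounds.
Variable R : realType.

Let ln2_gt0 : 0 < ln 2 :> R. Proof. by rewrite ln_gt0 // ltr1n. Qed.

(** This is ln(1 + x) <= x at x = -1/2. *)
Lemma ln2_ge_half : 1 / 2 <= ln 2 :> R.
Proof.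
have := @le_ln1Dx R (- (1 / 2)) ltac:(lra).
have -> : 1 + - (1 / 2) = 2^-1 :> R by lra.
by rewrite lnV ?posrE //; lra.
Qed.

Lemma log2X (x : R) (k : nat) : 0 < x -> log2 (x ^+ k) = k%:R * log2 x.
Proof. by move=> x0; rewrite /log2 lnXn // mulrA mulr_natl. Qed.

Lemma log2_pow2 (k : nat) : log2 (2 ^+ k : R) = k%:R.
Proof. by rewrite log2X // /log2 divff ?mulr1 ?gt_eqF. Qed.

Lemma ler_log2 (x y : R) : 0 < x -> x <= y -> log2 x <= log2 y.
Proof.
move=> x0 xy; rewrite /log2 ler_pM2r ?invr_gt0 // ler_ln ?posrE //.
exact: lt_le_trans xy.
Qed.

Lemma up_log_le_log2 (s : nat) : (1 < s)%N -> (up_log 2 s)%:R <= log2 (s%:R : R) + 1.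
Proof.
move=> s1; have /andP[lt_s _] := up_log_bounds (isT : 1 < 2)%N s1.
have: log2 ((2 ^ (up_log 2 s).-1)%:R : R) <= log2 s%:R.
  by apply: ler_log2; rewrite ?ltr0n ?expn_gt0 // ler_nat ltnW.
rewrite natrX log2_pow2 => le_log.
by rewrite -(prednK (_ : 0 < up_log 2 s)%N) ?up_log_gt0 // -natr1 lerD2r.
Qed.

(** Since the logarithm l of the size is at least 1, 48(l + 2) <= 144 l. *)
Lemma oblivious_median_real_bound (n M : nat)
    (P : branching_program n 'I_(2 * n) bool) :
  (0 < n)%N -> bp_oblivious P -> bp_computes P (@median_low_bit n) ->
  (2 * bp_length P < M.+1 * n)%N ->
  1 <= log2 ((bp_size P)%:R : R) /\
  n%:R <= (144 * log2 ((bp_size P)%:R : R)) ^+ (4 * M + 2).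
Proof.
move=> n0 obl comp leT; have S1 := bp_size_gt1 n0 comp.
have logS : 1 <= log2 ((bp_size P)%:R : R).
  by rewrite -[leLHS](log2_pow2 1) ler_log2 // expr1 ler_nat.
split=> //.
have := oblivious_median_exp_bound obl comp leT; rewrite -(ler_nat R) => /le_trans; apply.
rewrite natrX lerXn2r ?nnegrE ?ler0n //; first by lra.
have := up_log_le_log2 S1; rewrite natrM -natr1; lra.
Qed.

(** The right side is 4 exp(4k ln 2) >= 4 + 16k ln 2, and ln 2 >= 1/2. It turns the root of order 8k
    + 2 into the weaker one of the theorem. *)
Lemma exponent_le_powR (k : R) : 1 <= k -> 8 * k + 2 <= 2 `^ (4 * k + 2).
Proof.
move=> k1; have -> : 2 `^ (4 * k + 2) = 4 * expR (4 * k * ln 2) :> R.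
  rewrite powRD ?pnatr_eq0 ?implybT //; rewrite powR_mulrn // /powR pnatr_eq0 /= mulrC.
  by congr (_ * _); ring.
have := expR_ge1Dx (4 * k * ln 2); have := ln2_ge_half; nra.
Qed.

(** The left side is at most 2 * 18w * 2w = 72 w^2, below 1 + w^3/6 once w >= 432. *)
Lemma quadratic_lt_expR (C m w : R) : 0 <= C -> 0 <= m -> 1459 + C <= w ->
  m <= 4 * w -> 2 * ((4 * m + 2) * (C + w)) < expR w.
Proof.
move=> C0 m0 Cw mw; have w0 : 0 < w by lra.
apply: (@le_lt_trans _ _ (72 * w ^+ 2)).
  by rewrite expr2; nra.
apply: lt_le_trans (expR_ge1Dxn 2 (ltW w0)); rewrite (_ : 3`! = 6)%N //.
have : 432 * w ^+ 2 <= w * w ^+ 2 by rewrite ler_wpM2r ?sqr_ge0 //; lra.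
by rewrite exprS; lra.
Qed.

End RealBounds.

(** * The two asymptotic bounds *)

Theorem corollary7 (R : realType) :
  (exists (c : R) (a : nat), 0 < c /\
    \forall n \near \oo,
      forall (k : R) (P : branching_program n 'I_(2 * n) bool),
        1 <= k ->
        bp_oblivious P ->
        bp_computes P (@median_low_bit n) ->
        (bp_length P)%:R <= k * n%:R ->
        2 `^ (c * n%:R `^ (1 / 2 `^ (4 * k + 2)) / log2 n%:R ^+ a)
          <= (bp_size P)%:R)
  /\
  (forall T : nat -> nat,
    (fun n : nat => (T n)%:R : R^o) =o_\oo
      (fun n : nat => n%:R * log2 (log2 n%:R) : R^o) ->
    forall d : nat,
      \forall n \near \oo,
        forall P : branching_program n 'I_(2 * n) bool,
          bp_oblivious P ->
          bp_computes P (@median_low_bit n) ->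
          (bp_length P <= T n)%N ->
          (n ^ d <= bp_size P)%N).
Proof.
split.
  (* No logarithmic factor is lost; 144 is the constant of [oblivious_median_real_bound]. *)
  exists (1 / 144), 0%N; split; first by lra.
  near=> n => k P k1 obl comp lenP.
  have n0 : (0 < n)%N by near: n; exists 1%N.
  have nR0 : 0 < n%:R :> R by rewrite ltr0n.
  (* This gives 2 * length <= 2kn < (M + 1)n and 4M + 2 <= 8k + 2. *)
  pose M := Num.truncn (2 * k).
  have /truncn_itv/andP[leM ltM] : 0 <= 2 * k by lra.
  have [|logS le_n] := @oblivious_median_real_bound R n M P n0 obl comp.
    by rewrite -(ltr_nat R) !natrM; nra.
  set D := 2 `^ (4 * k + 2).
  have leD : (4 * M + 2)%:R <= D.
    by apply: le_trans (exponent_le_powR k1); rewrite natrD natrM; rewrite -/M in leM; lra.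
  have D0 : 0 < D by rewrite powR_gt0.
  set l := 144 * log2 _ in le_n.
  have l1 : 1 <= l by rewrite /l; lra.
  have le_root : n%:R `^ (1 / D) <= l.
    have -> : l = (l `^ D) `^ (1 / D) by rewrite -powRrM mul1r divff ?gt_eqF // powRr1 //; lra.
    apply: ge0_ler_powR; rewrite ?nnegrE ?powR_ge0 ?divr_ge0 ?(ltW D0) ?(ltW nR0) //.
    apply: le_trans le_n _; rewrite -powR_mulrn; last by lra.
    exact: ler_powR.
  rewrite expr0 divr1.
  have S0 : 0 < (bp_size P)%:R :> R by rewrite ltr0n; apply: ltnW; apply: bp_size_gt1 comp.
  have -> : (bp_size P)%:R = 2 `^ (log2 (bp_size P)%:R) :> R.
    by rewrite /powR pnatr_eq0 /= divfK ?gt_eqF ?ln_gt0 ?ltr1n // lnK ?posrE.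
  by rewrite ler_powR ?ler1n //; rewrite /l in le_root; lra.
move=> T oT [|d]; first by near=> n => P _ _ _; rewrite expn0; apply/card_gt0P; exists (bp_source P).
have C0 : 0 <= ln (144 * d.+1%:R) :> R by apply: ln_ge0; rewrite -natrM ler1n.
near=> n => P obl comp lenP; rewrite leqNgt; apply/negP => ltS.
(* This threshold makes w = ln(log2 n) large enough for [quadratic_lt_expR]. *)
have big_n : expR (expR (1459 + ln (144 * d.+1%:R)) * ln 2) <= n%:R :> R.
  by near: n; exact: nbhs_infty_ger.
have nR0 : 0 < n%:R :> R by apply: lt_le_trans big_n; exact: expR_gt0.
have n0 : (0 < n)%N by rewrite ltr0n in nR0.
have ln2_gt0 : 0 < ln 2 :> R by rewrite ln_gt0 // ltr1n.
have big_log : expR (1459 + ln (144 * d.+1%:R)) <= log2 n%:R :> R.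
  by rewrite /log2 ler_pdivlMr // -[leLHS]expRK ler_ln ?posrE ?expR_gt0.
have log_gt0 : 0 < log2 n%:R :> R by apply: lt_le_trans big_log; exact: expR_gt0.
set w := ln (log2 n%:R : R).
have big_w : 1459 + ln (144 * d.+1%:R) <= w.
  by rewrite -[leLHS]expRK ler_ln ?posrE ?expR_gt0.
have w0 : 0 <= w by apply: le_trans big_w; rewrite addr_ge0 ?ler0n.
(* The little-o hypothesis is applied with constant 1. *)
have leT : (T n)%:R <= n%:R * (w / ln 2).
  have : `|(T n)%:R : R^o| <= 1 * `|n%:R * log2 (log2 n%:R) : R^o|.
    by near: n; move/eqoP: oT; apply.
  by rewrite mul1r ger0_norm // ger0_norm // mulr_ge0 // /log2 -/w divr_ge0 ?(ltW ln2_gt0).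
pose M := ((2 * T n) %/ n)%N.
have [|logS le_n] := @oblivious_median_real_bound R n M P n0 obl comp.
  by apply: leq_ltn_trans (ltn_ceil _ n0); rewrite leq_mul2l lenP.
have leM : M%:R <= 4 * w.
  have : M%:R * n%:R <= 2 * (T n)%:R :> R by rewrite -!natrM ler_nat leq_trunc_div.
  move=> h1; rewrite -(ler_pM2r nR0); apply: le_trans h1 _.
  have : w / ln 2 <= 2 * w.
    by rewrite ler_pdivrMr // mulrAC -[leLHS]mul1r ler_wpM2r //; have := ln2_ge_half R; lra.
  by move: leT; nra.
have le_logS : log2 ((bp_size P)%:R : R) <= d.+1%:R * log2 n%:R.
  have : log2 ((bp_size P)%:R : R) <= log2 (n%:R ^+ d.+1).
    apply: ler_log2; last by rewrite -natrX ler_nat ltnW.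
    by rewrite ltr0n; apply: ltnW; apply: bp_size_gt1 comp.
  by rewrite log2X.
(* A size below n^(d+1) makes ln n at most quadratic in [w], whereas exp(w) = log2 n <= 2 ln n: a
   contradiction. *)
have ln_n : ln (n%:R : R) <= (4 * M + 2)%:R * (ln (144 * d.+1%:R) + w).
  rewrite -lnM ?posrE //.
  have y0 : 0 < 144 * d.+1%:R * log2 n%:R :> R by rewrite mulr_gt0 // mulr_gt0 // ltr0n.
  move: y0; set y := (X in 0 < X) => y0; rewrite [leRHS]mulr_natl -lnXn //.
  rewrite ler_ln ?posrE ?exprn_gt0 //; apply: le_trans le_n _.
  rewrite lerXn2r ?nnegrE ?(ltW y0) //; last by rewrite /y -mulrA ler_pM2l ?ltr0n.
  by rewrite mulr_ge0 ?ler0n // (le_trans ler01 logS).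
have := quadratic_lt_expR C0 (ler0n R M) big_w leM; rewrite ltNge => /negP; apply.
rewrite lnK ?posrE //; apply: le_trans (_ : 2 * ln n%:R <= _); last first.
  by rewrite ler_pM2l ?ltr0n //; move: ln_n; rewrite natrD natrM.
have ln0 : 0 <= ln n%:R :> R by rewrite ln_ge0 // ler1n.
rewrite /log2 ler_pdivrMr // mulrAC -[leLHS]mul1r ler_wpM2r //.
by have := ln2_ge_half R; move: (ln 2) => l; lra.
Unshelve. all: by end_near.
Qed.
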